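(* Let $\mathcal E$ be a discrete asymmetric information economy with commodity space a Banach lattice $Y$ and let $\mathcal E_c$ be the associated continuum economy. Assume that the positive cone $Y_+$ has a (norm) interior point. Assume: (Continuity) for all $i\in N$, $\omega\in\Omega$, $U_i(\omega,\cdot)$ is norm-continuous on $Y_+$; (Monotonicity) for all $i\in N$, $\omega\in\Omega$, if $x,y\in Y_+$ and $y>0$ then $U_i(\omega,x+y)>U_i(\omega,x)$; (Quasi-interiority) for each $\omega\in\Omega$, $\sum_{i\in N}a_i(\omega)$ is a quasi-interior point of $Y_+$. Let $f$ be a feasible allocation in $\mathcal E_c$ such that $f(t,\cdot)=x_i$ for all $t\in I_i$ and $i\in N$. If $f$ is in the private core of $\mathcal E_c$, then there is a non-zero $\pi:\Omega\to Y_+^*$ such that $(f,\pi)$ is a non-trivial Walrasian expectations quasi-equilibrium of $\mathcal E_c$.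
   Context: **Discrete economy.** $N=\{1,\dots,n\}$ is a finite set of agents; $(\Omega,\mathcal F)$ is a measurable space with $\Omega$ finite; $Y$ is a Banach lattice with positive cone $Y_+$, norm dual $Y^*$, and positive dual cone $Y_+^*$. For $y\in Y$, $y>0$ means $y\ge 0$ and $y\neq 0$. A point $y\in Y_+$ is a quasi-interior point of $Y_+$ if the principal ideal $L(y)=\{z\in Y: |z|\le m|y| \text{ for some } m\in\mathbb N\}$ is norm dense in $Y$. A discrete economy $\mathcal E$ consists, for each $i\in N$, of a partition $\mathcal F_i$ of $\Omega$ into events (private information), a random utility $U_i:\Omega\times Y_+\to\mathbb R$, a random initial endowment $a_i:\Omega\to Y_+$ that is constant on elements of $\mathcal F_i$, and a prior $q_i$, a probability measure on $\Omega$ with $q_i(\omega)>0$ for all $\omega$. The ex ante expected utility is $V_i(x)=\sum_{\omega\in\Omega}U_i(\omega,x(\omega))q_i(\omega)$ for $x:\Omega\to Y_+$. A function on $\Omega$ is $\mathcal F_i$-measurable if it is constant on elements of $\mathcal F_i$; $L_i=\{x\in (Y_+)^\Omega: x \text{ is } \mathcal F_i\text{-measurable}\}$. **Price systems and budget sets.** A price system is an $\mathcal F$-measurable non-zero function $\pi:\Omega\to Y_+^*$, and $B_i(\pi)=\{x\in L_i:\sum_{\omega}\langle\pi(\omega),x(\omega)\rangle\le\sum_{\omega}\langle\pi(\omega),a_i(\omega)\rangle\}$. **Continuum economy $\mathcal E_c$.** The agent space is $I=[0,1]$ with Lebesgue measure $\mu$, $I_i=[\frac{i-1}{n},\frac in)$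 for $i<n$ and $I_n=[\frac{n-1}{n},1]$. Each $t\in I_i$ has $L_t=L_i$, $a(t,\cdot)=a_i$, $V_t=V_i$, $B_t(\pi)=B_i(\pi)$. An assignment is $f:I\times\Omega\to Y_+$ with $f(\cdot,\omega)$ Bochner integrable for every $\omega$; it is an allocation if $f(t,\cdot)\in L_t$ for almost all $t$; an allocation is feasible if $\int_I f(t,\omega)d\mu(t)\le\int_I a(t,\omega)d\mu(t)$ for all $\omega$. A coalition is a Borel set $S\subseteq I$ with $\mu(S)>0$. It privately blocks an allocation $f$ if there is $g:S\times\Omega\to Y_+$ (Bochner integrable in $t$ for each $\omega$) with $g(t,\cdot)\in L_t$ and $V_t(g(t,\cdot))>V_t(f(t,\cdot))$ for all $t\in S$ and $\int_S g(t,\omega)d\mu(t)\le\int_S a(t,\omega)d\mu(t)$ for all $\omega$. The private core of $\mathcal E_c$ is the set of feasible allocations not privately blocked by any coalition. **Quasi-equilibrium of $\mathcal E_c$.** For a feasible allocation $f$ and price system $\pi$, $(f,\pi)$ is a Walrasian expectations quasi-equilibrium if (i) for all $t\in I$, $f(t,\cdot)\in B_t(\pi)$, and $f(t,\cdot)$ maximizes $V_t$ on $B_t(\pi)$ whenever $\sum_\omega\langle\pi(\omega),a(t,\omega)\rangle\ne 0$; and (ii) $\sum_\omega\langle\pi(\omega),\int_I f(t,\omega)d\mu(t)\rangle=\sum_\omega\langle\pi(\omega),\int_I a(t,\omega)d\mu(t)\rangle$. It is non-trivial if $\sum_\omega\langle\pi(\omega),a(t,\omega)\rangle\ne 0$ for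 all $t$ in some coalition. *)

(* Defs.v *)
From HB Require Import structures.
From mathcomp Require Import all_boot all_order all_algebra.
From mathcomp Require Import all_classical all_reals all_analysis.
Set Implicit Arguments.
Unset Strict Implicit.
Unset Printing Implicit Defensive.
Import Order.TTheory GRing.Theory Num.Theory.
Import numFieldNormedType.Exports.
Local Open Scope classical_set_scope.
Local Open Scope ring_scope.

(* The lattice order is a field of the mixin rather than an [Order.Lattice]
   structure: HB rejects a join of [Order.POrder] and [NormedModule], because
   [Num.NumDomain] already inherits from ancestors of both without a common
   join.  [`|x|] is the norm; the modulus of [x] is [vabs x] below. *)
HB.mixin Record isBanachLattice (R : realType) (Y : Type)
    of CompleteNormedModule R Y := {
  vle : rel Y ;
  vsup : Y -> Y -> Y ;
  vinf : Y -> Y -> Y ;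
  vle_refl : reflexive vle ;
  vle_anti : antisymmetric vle ;
  vle_trans : transitive vle ;
  vsup_vle : forall x y z : Y, vle (vsup x y) z = vle x z && vle y z ;
  vle_vinf : forall x y z : Y, vle z (vinf x y) = vle z x && vle z y ;
  vleD2r : forall z x y : Y, vle x y -> vle (x + z) (y + z) ;
  vleZ2l : forall (c : R) (x y : Y), 0 <= c -> vle x y -> vle (c *: x) (c *: y) ;
  vle_norm : forall x y : Y,
    vle (vsup x (- x)) (vsup y (- y)) -> `|x| <= `|y|
}.

#[short(type="banachLatticeType")]
HB.structure Definition BanachLattice (R : realType) :=
  { Y of CompleteNormedModule R Y & isBanachLattice R Y }.

Notation "x <=^v y" := (vle x y) (at level 70, no associativity) : ring_scope.
Notation "x <^v y" := ((x <=^v y) && (x != y))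
  (at level 70, no associativity) : ring_scope.

Section BanachLatticeNotions.
Context {R : realType} {Y : banachLatticeType R}.

Definition vabs (x : Y) : Y := vsup x (- x).

Definition positive_cone : set Y := [set y | 0 <=^v y].

Definition principal_ideal (y : Y) : set Y :=
  [set z | exists m : nat, vabs z <=^v vabs y *+ m].

Definition quasi_interior (y : Y) : Prop :=
  positive_cone y /\ dense (principal_ideal y).

(* Elements of the positive cone of the norm dual. *)
Definition positive_dual (p : {linear Y -> R^o}) : Prop :=
  continuous p /\ forall y, positive_cone y -> 0 <= p y.

End BanachLatticeNotions.
Arguments positive_cone {R} Y.

Section Bochner.
Context {d : measure_display} {T : measurableType d} {R : realType}
        {Y : completeNormedModType R} (mu : {measure set T -> \bar R}).

Definition simple_on (D : set T) (s : {fimfun T >-> Y}) : Prop :=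
  forall y, measurable (D `&` s @^-1` [set y]) /\
    (y != 0 -> (mu (D `&` s @^-1` [set y]) < +oo)%E).

Definition simple_integral (D : set T) (s : {fimfun T >-> Y}) : Y :=
  \sum_(y \in [set: Y]) fine (mu (D `&` s @^-1` [set y])) *: y.

(* The integral of the norm below is that of an a.e. limit of measurable
   functions.  It is the Lebesgue integral even if [f] is measurable only for
   the completion of [mu], since [\int] of a nonnegative function is the
   supremum of the integrals of the measurable simple functions below it. *)
Definition bochner_approx (D : set T) (f : T -> Y)
    (s : nat -> {fimfun T >-> Y}) : Prop :=
  [/\ forall k, simple_on D (s k),
      {ae mu, forall t, D t -> s k t @[k --> \oo] --> f t} &
      (\int[mu]_(t in D) (`|f t - s k t|)%:E)%E @[k --> \oo] --> 0%E ].

Definition bochner_integrable (D : set T) (f : T -> Y) : Prop :=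
  exists s, bochner_approx D f s.

Definition is_bochner_integral (D : set T) (f : T -> Y) (v : Y) : Prop :=
  exists2 s, bochner_approx D f s &
    simple_integral D (s k) @[k --> \oo] --> v.

(* The value is [0] if [f] is not Bochner integrable on [D]. *)
Definition bochner_integral (D : set T) (f : T -> Y) : Y :=
  xget 0 [set v | is_bochner_integral D f v].

End Bochner.

(* The state space is a finite type [Omega] with sigma-algebra [F]; there are
   [n.+1] agents, numbered from [0]. *)
Record economy (R : realType) (Omega : finType) (F : set (set Omega))
    (Y : banachLatticeType R) (n : nat) := Economy {
  info : 'I_n.+1 -> {set {set Omega}} ;
  info_partition : forall i, finset.partition (info i) [set: Omega]%SET ;
  info_event : forall i (B : {set Omega}), B \in info i -> F [set` B] ;
  (* only the values of [utility i w] on the positive cone are relevant *)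
  utility : 'I_n.+1 -> Omega -> Y -> R ;
  endowment : 'I_n.+1 -> Omega -> Y ;
  endowment_pos : forall i w, positive_cone Y (endowment i w) ;
  endowment_info : forall i (B : {set Omega}), B \in info i ->
    {in B &, forall w w', endowment i w = endowment i w'} ;
  prior : 'I_n.+1 -> Omega -> R ;
  prior_gt0 : forall i w, 0 < prior i w ;
  prior_sum1 : forall i, \sum_w prior i w = 1
}.

Section Economy.
Context {R : realType} {Omega : finType} {F : set (set Omega)}
        {Y : banachLatticeType R} {n : nat} (E : economy F Y n).

Definition expected_utility (i : 'I_n.+1) (x : Omega -> Y) : R :=
  \sum_w utility E i w (x w) * prior E i w.

Definition info_measurable (i : 'I_n.+1) (x : Omega -> Y) : Prop :=
  forall B : {set Omega}, B \in info E i ->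
    {in B &, forall w w', x w = x w'}.

Definition consumption (i : 'I_n.+1) : set (Omega -> Y) :=
  [set x | (forall w, positive_cone Y (x w)) /\ info_measurable i x].

(* As [Omega] is finite, [pi] takes finitely many values and is [F]-measurable
   as soon as its fibres are in [F]. *)
Definition price_system (pi : Omega -> {linear Y -> R^o}) : Prop :=
  [/\ forall w, positive_dual (pi w),
      forall p : Y -> R, F [set w | (pi w : Y -> R) = p] &
      exists w y, pi w y != 0 ].

Definition value (pi : Omega -> {linear Y -> R^o}) (x : Omega -> Y) : R :=
  \sum_w pi w (x w).

Definition budget (i : 'I_n.+1) (pi : Omega -> {linear Y -> R^o}) :
    set (Omega -> Y) :=
  [set x | consumption i x /\ value pi x <= value pi (endowment E i)].

Definition continuous_utility : Prop :=
  forall i w, {within positive_cone Y, continuous (utility E i w)}.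

Definition monotone_utility : Prop :=
  forall i w (x y : Y), positive_cone Y x -> 0 <^v y ->
    utility E i w x < utility E i w (x + y).

Definition quasi_interior_endowment : Prop :=
  forall w, quasi_interior (\sum_i endowment E i w).

Definition agents : set R := `[0, 1].

Definition agents_of_type (i : 'I_n.+1) : set R :=
  if i == ord_max then `[i%:R / n.+1%:R, 1]%classic
  else `[i%:R / n.+1%:R, i.+1%:R / n.+1%:R[%classic.

(* The value outside [agents] is irrelevant. *)
Definition agent_type (t : R) : 'I_n.+1 :=
  odflt ord0 [pick i | t \in agents_of_type i].

Lemma agent_typeP (t : R) (i : 'I_n.+1) :
  agents_of_type i t -> agent_type t = i.
Proof.
have key (j k : 'I_n.+1) : agents_of_type j t -> agents_of_type k t -> (j <= k)%N.
  have lo (m : 'I_n.+1) : agents_of_type m t -> m%:R <= t * n.+1%:R :> R.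
    by rewrite /agents_of_type; case: ifP => _ /=; rewrite in_itv /= => /andP[];
      rewrite ler_pdivrMr.
  move=> /lo hj; rewrite /agents_of_type; case: eqP => [->|_] /=.
    by rewrite -ltnS.
  rewrite in_itv /= => /andP[_]; rewrite ltr_pdivlMr// => /(le_lt_trans hj).
  by rewrite ltr_nat ltnS.
move=> hi; rewrite /agent_type; case: pickP => [j /set_mem hj|/(_ i)] /=.
  by apply/val_inj/eqP; rewrite eqn_leq !key.
by rewrite mem_set.
Qed.

Notation mu := (@lebesgue_measure R).

Definition endowment_c (t : R) : Omega -> Y := endowment E (agent_type t).
Definition expected_utility_c (t : R) := expected_utility (agent_type t).
Definition consumption_c (t : R) := consumption (agent_type t).
Definition budget_c (t : R) := budget (agent_type t).

Definition assignment_on (S : set R) (f : R -> Omega -> Y) : Prop :=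
  (forall t w, S t -> positive_cone Y (f t w)) /\
  (forall w, bochner_integrable mu S (f ^~ w)).

Definition allocation (f : R -> Omega -> Y) : Prop :=
  assignment_on agents f /\
  {ae mu, forall t, agents t -> consumption_c t (f t)}.

Definition feasible_on (S : set R) (f : R -> Omega -> Y) : Prop :=
  forall w, bochner_integral mu S (f ^~ w) <=^v
            bochner_integral mu S (endowment_c ^~ w).

Definition coalition (S : set R) : Prop :=
  [/\ measurable S, S `<=` agents & (0 < mu S)%E].

Definition privately_blocks (S : set R) (f : R -> Omega -> Y) : Prop :=
  exists g : R -> Omega -> Y,
    [/\ assignment_on S g,
        forall t, S t -> consumption_c t (g t),
        forall t, S t -> expected_utility_c t (f t) < expected_utility_c t (g t) &
        feasible_on S g ].

Definition private_core : set (R -> Omega -> Y) :=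
  [set f | [/\ allocation f, feasible_on agents f &
     forall S, coalition S -> ~ privately_blocks S f ]].

Definition quasi_equilibrium (f : R -> Omega -> Y)
    (pi : Omega -> {linear Y -> R^o}) : Prop :=
  [/\ allocation f, feasible_on agents f, price_system pi,
      forall t, agents t ->
        budget_c t pi (f t) /\
        (value pi (endowment_c t) != 0 ->
         forall x, budget_c t pi x ->
           expected_utility_c t x <= expected_utility_c t (f t)) &
      value pi (fun w => bochner_integral mu agents (f ^~ w)) =
      value pi (fun w => bochner_integral mu agents (endowment_c ^~ w)) ].

Definition nontrivial_price (pi : Omega -> {linear Y -> R^o}) : Prop :=
  exists2 S, coalition S & forall t, S t -> value pi (endowment_c t) != 0.

End Economy.

(* Main.v *)
From HB Require Import structures.
Require Import Defs.
From mathcomp Require Import all_boot all_order all_algebra finmap.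
From mathcomp Require Import all_classical all_reals all_analysis.
From mathcomp Require Import measurable_realfun lra.
Set Implicit Arguments.
Unset Strict Implicit.
Unset Printing Implicit Defensive.
Import Order.TTheory GRing.Theory Num.Theory.
Import numFieldNormedType.Exports.
Local Open Scope classical_set_scope.
Local Open Scope ring_scope.

(** Work in the vector space of functions [Omega -> Y].  Call a bundle [z] of
    type [i] improving if it lies in the consumption set of [i] and is strictly
    preferred to [x i].  The functions that dominate a nonnegative combination
    of net trades [z - endowment E i], with [z] improving for [i], form a convex
    cone.

    Let [u] be an interior point of the positive cone of [Y].  The cone does not
    contain the constant function [- u]: otherwise some combination of net
    trades with nonnegative weights, not all zero, would be nonpositive.  After
    a common rescaling, the weights are the lengths of disjoint intervals of
    agents of the relevant types, and the agents of these intervals block [f] by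
    consuming their improving bundles ([core_no_dominated_trades]).  The
    freedom to split the agents of one type among several bundles is what makes
    convex combinations available.  What is needed from the Bochner integral is
    its value on step functions
    ([bochner_integral_labels]); the uniqueness part of that statement rests on
    comparing two simple functions on a common refinement of their level sets.

    As [u] is an order unit, the cone is separated from [- u] by a linear form
    [p] with [p u = 1] that is nonnegative on the cone ([cone_separation]): by
    Zorn's lemma the cone extends to one that induces a total preorder, and [p]
    is the Dedekind cut of the multiples of [u] in that preorder.  Thus [p] is
    positive, hence continuous, and an improving bundle of type [i] costs at
    least as much as the endowment of [i] ([supporting_price]).

    The prices [y |-> p (y at state w)] need not be measurable for the
    sigma-algebra [F]; averaging them over the atoms of [F] makes them so, and
    does not change the value of bundles that are constant on atoms
    ([averaged_price_value], [saturated_measurable]).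

    Finally, by monotonicity [x i] is a limit of improving bundles, so it costs
    at least as much as [endowment E i]; summing over [i], feasibility turns
    these inequalities into equalities.  If the wealth of [i] is positive, an
    improving bundle [z] within the budget would remain improving after a slight
    shrinking, by continuity, while costing strictly less than the endowment, a
    contradiction.  Some type has positive wealth because a positive functional
    that vanishes at a quasi-interior point also vanishes at [u]
    ([quasi_interior_price]). *)

(** * Separation of a convex cone from a point *)

Section ConeSeparation.
Context {R : realType} {V : lmodType R}.
Implicit Types (K C : set V) (u v w : V).

Definition convex_cone K : Prop :=
  [/\ K 0, forall v w, K v -> K w -> K (v + w) &
      forall (c : R) v, 0 <= c -> K v -> K (c *: v)].

(** If neither [v] nor [- v] could be adjoined to a maximal cone, then [- u]
    would be a positive combination of the two failures, with [v] cancelled. *)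
Lemma maximal_cone C u : convex_cone C -> ~ C (- u) ->
  exists K, [/\ convex_cone K, C `<=` K, ~ K (- u) &
    forall v, K v \/ K (- v)].
Proof.
move=> cC Cu.
(* The empty set is included because the union of the empty chain is empty. *)
pose P K := K = set0 \/ [/\ convex_cone K, C `<=` K & ~ K (- u)].
have [|K [PK maxK]] := @Zorn_bigcup V P.
  move=> Fs FP tot.
  have [[K0 FK0 [v0 K0v0]]|Fempty] :=
      pselect (exists2 K, Fs K & exists v, K v); last first.
    left; apply/seteqP; split=> // v [K FK Kv].
    by apply: Fempty; exists K => //; exists v.
  have coneF K v : Fs K -> K v -> [/\ convex_cone K, C `<=` K & ~ K (- u)].
    by move=> FK Kv; case: (FP _ FK) => // K0'; rewrite K0' in Kv.
  have [cK0 CK0 _] := coneF _ _ FK0 K0v0.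
  right; split.
  - split; first by exists K0 => //; case: cK0.
    + move=> v w [K FK Kv] [L FL Lw].
      have [KL|LK] := tot _ _ FK FL.
        by exists L => //; case: (coneF _ _ FL Lw) => -[_ + _] _ _; apply=> //; exact: KL.
      by exists K => //; case: (coneF _ _ FK Kv) => -[_ + _] _ _; apply=> //; exact: LK.
    + move=> c v c0 [K FK Kv]; exists K => //.
      by case: (coneF _ _ FK Kv) => -[_ _ +] _ _; apply.
  - by move=> v Cv; exists K0 => //; exact: CK0.
  - by move=> [K FK Ku]; case: (coneF _ _ FK Ku) => _ _; apply.
have {PK} [cK CK Ku] : [/\ convex_cone K, C `<=` K & ~ K (- u)].
  case: PK => // K0; exfalso; apply: (maxK C); last by right; split.
  by rewrite K0; split=> // /(_ 0); apply; case: cC.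
exists K; split=> // v; apply: contrapT => /not_orP[nKv nKNv].
case: (cK) => K0 KD KZ.
(* By maximality, adjoining a vector outside [K] puts [- u] in the cone. *)
have adjoin w : ~ K w -> exists k (t : R), [/\ K k, 0 <= t & k + t *: w = - u].
  move=> nKw; apply: contrapT => nadj.
  pose L := [set z | exists k (t : R), [/\ K k, 0 <= t & z = k + t *: w]].
  apply: (maxK L).
    split; first by move=> z Kz; exists z, 0; rewrite scale0r addr0.
    by move=> LK; apply: nKw; apply: LK; exists 0, 1; rewrite scale1r add0r.
  right; split.
  - split.
    + by exists 0, 0; rewrite scale0r addr0.
    + move=> _ _ [k [t [Kk t0 ->]]] [k' [t' [Kk' t'0 ->]]].
      exists (k + k'), (t + t'); split; [exact: KD|exact: addr_ge0|].
      by rewrite scalerDl addrACA.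
    + move=> c _ c0 [k [t [Kk t0 ->]]].
      exists (c *: k), (c * t); split; [exact: KZ|exact: mulr_ge0|].
      by rewrite scalerDr scalerA.
  - by move=> z Cz; exists z, 0; rewrite scale0r addr0; split=> //; exact: CK.
  - by move=> [k [t [Kk t0 e]]]; apply: nadj; exists k, t.
have [k [t [Kk t0 ek]]] := adjoin _ nKv.
have [k' [t' [Kk' t'0 ek']]] := adjoin _ nKNv.
have tt' : 0 < t + t'.
  rewrite lt_neqAle addr_ge0// andbT eq_sym; apply/eqP => t00.
  have t00' : t = 0 by lra.
  by apply: Ku; rewrite -ek t00' scale0r addr0.
apply: Ku.
have e : t' *: k + t *: k' = (t + t') *: - u.
  have -> : k = - u - t *: v by rewrite -ek addrK.
  have -> : k' = - u + t' *: v by rewrite -ek' scalerN subrK.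
  rewrite scalerBr scalerDr !scalerA [t * t']mulrC.
  by rewrite addrACA addNr addr0 -scalerDl [t' + t]addrC.
have -> : - u = (t + t')^-1 *: (t' *: k + t *: k').
  by rewrite e scalerA mulVf ?scale1r// gt_eqF.
apply: (KZ); first by rewrite invr_ge0 ltW.
by apply: (KD); exact: KZ.
Qed.

(** For a cone [K] that compares any two vectors, the cut
    [v |-> sup {a | v - a u in K}] is superadditive and odd, hence linear. *)
Lemma cone_separation C u : convex_cone C -> ~ C (- u) ->
  (forall v, exists2 a : R, 0 <= a & C (a *: u - v)) ->
  exists p : {linear V -> R^o}, p u = 1 /\ forall v, C v -> 0 <= p v.
Proof.
move=> cC nCu unit_u.
have [K [[K0 KD KZ] CK nKu Ktot]] := maximal_cone cC nCu.
pose cut v := [set a : R | K (v - a *: u)].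
pose p v : R := sup (cut v).
have Ku : K u by case: (Ktot u).
have Kau a : K (a *: u) -> 0 <= a.
  move=> Ka; rewrite leNgt; apply/negP => a0; apply: nKu.
  have -> : - u = (- a)^-1 *: (a *: u).
    by rewrite scalerA invrN mulNr mulVf ?scaleN1r// lt_eqF.
  by apply: (KZ) => //; rewrite invr_ge0 oppr_ge0 ltW.
have cutS v : has_sup (cut v).
  split.
    have [a _ Ca] := unit_u (- v); exists (- a).
    by rewrite /cut /= scaleNr opprK addrC -[v]opprK; exact: CK.
  have [b _ /CK Kb] := unit_u v; exists b => a /= Ka.
  by rewrite -subr_ge0; apply: Kau; have := KD _ _ Kb Ka; rewrite addrA subrK -scalerBl.
have le_p v a : K (v - a *: u) -> a <= p v.
  by move=> Ka; apply: ub_le_sup => //; case: (cutS v).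
have p_le v b : (forall a, K (v - a *: u) -> a <= b) -> p v <= b.
  by move=> vb; apply: ge_sup => //; case: (cutS v).
have lt_p v a : a < p v -> K (v - a *: u).
  move=> av; have [b /= Kb ab] := sup_gt (cutS v).1 av.
  have -> : v - a *: u = (v - b *: u) + (b - a) *: u by rewrite scalerBl addrA subrK.
  by apply: (KD) => //; apply: (KZ) => //; rewrite subr_ge0 ltW.
have pD v w : p v + p w <= p (v + w).
  rewrite -lerBrDr; apply: (p_le) => a Ka; rewrite lerBrDr addrC -lerBrDr.
  apply: (p_le) => b Kb; rewrite lerBrDr; apply: (le_p).
  by rewrite [b + a]addrC scalerDl opprD addrACA; exact: KD.
have p0 : p 0 = 0.
  apply/eqP; rewrite eq_le; apply/andP; split.
    by apply: (p_le) => a; rewrite sub0r -scaleNr => /Kau; rewrite oppr_ge0.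
  by apply: (le_p); rewrite scale0r subrr.
have pN v : p (- v) = - p v.
  apply/eqP; rewrite eq_le; apply/andP; split.
    by rewrite -subr_le0 opprK addrC (le_trans (pD _ _))// subrr p0.
  rewrite leNgt; apply/negP => pNv.
  have [a [pva apN]] : exists a, p v < a /\ a < - p (- v).
    by exists ((p v - p (- v)) / 2); split; lra.
  have [/le_p|] := Ktot (v - a *: u); first by rewrite leNgt pva.
  rewrite opprB addrC -[a]opprK scaleNr => /le_p; lra.
have pDE v w : p (v + w) = p v + p w.
  apply/eqP; rewrite eq_le pD andbT -lerBlDr -pN.
  by rewrite (le_trans (pD _ _))// addrK.
have pZ_ge0 c v : 0 < c -> p (c *: v) = c * p v.
  have half d w : 0 < d -> p (d *: w) <= d * p w.
    move=> d0; apply: (p_le) => a Ka; rewrite mulrC -ler_pdivrMr//; apply: (le_p).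
    have -> : w - (a / d) *: u = d^-1 *: (d *: w - a *: u).
      by rewrite scalerBr !scalerA mulVf ?gt_eqF// scale1r [d^-1 * a]mulrC.
    by apply: (KZ) => //; rewrite invr_ge0 ltW.
  move=> c0; apply/eqP; rewrite eq_le half//= mulrC -ler_pdivlMr//.
  have := half c^-1 (c *: v); rewrite invr_gt0 scalerA mulVf ?gt_eqF// scale1r.
  by rewrite [_ / c]mulrC; exact.
have pZ c v : p (c *: v) = c * p v.
  have [c0|c0|->] := ltgtP c 0; last by rewrite scale0r p0 mul0r.
    by have := pZ_ge0 (- c) v; rewrite scaleNr pN mulNr oppr_gt0 => /(_ c0)/oppr_inj.
  exact: pZ_ge0.
have plin : linear (p : V -> R^o) by move=> c v w; rewrite pDE pZ.
pose pl : {linear V -> R^o} := HB.pack p (GRing.isLinear.Build _ _ _ _ p plin).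
exists pl; split; last by move=> v /CK Kv; apply: (le_p); rewrite scale0r subr0.
apply/eqP; rewrite eq_le; apply/andP; split.
  apply: (p_le) => a; rewrite -{1}[u]scale1r -scalerBl => /Kau.
  by rewrite subr_ge0.
by apply: (le_p); rewrite scale1r subrr.
Qed.
End ConeSeparation.

(** * Bochner integrals of step functions *)

Section LabelledStepFunctions.
Context {d : measure_display} {T : measurableType d} {R : realType}
        {Y : completeNormedModType R} (mu : {measure set T -> \bar R}).

(** A step function on [D] is presented as [y \o h] for a map [h] to a finite
    type of labels, so that no disjointness has to be stated. *)
Definition measurable_labels (K : finType) (D : set T) (h : T -> K) : Prop :=
  forall k, measurable (D `&` h @^-1` [set k]).

Definition weight (K : finType) (D : set T) (h : T -> K) (k : K) : R :=
  fine (mu (D `&` h @^-1` [set k])).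

Section FixedLabels.
Context (K : finType) (D : set T) (h : T -> K).
Hypotheses (mh : measurable_labels D h) (Dfin : (mu D < +oo)%E).

Lemma labels_cover (P : pred K) :
  D `&` h @^-1` [set` P] = \bigcup_(k in [set` P]) (D `&` h @^-1` [set k]).
Proof.
apply/seteqP; split=> [t [Dt Pt]|t [k Pk [Dt htk]]]; first by exists (h t).
by split=> //; rewrite /preimage /= htk.
Qed.

Lemma labels_measurable (P : pred K) : measurable (D `&` h @^-1` [set` P]).
Proof.
by rewrite labels_cover; apply: fin_bigcup_measurable => //; exact: finite_finset.
Qed.

Lemma labels_domain_measurable : measurable D.
Proof.
have := labels_measurable predT; rewrite (_ : D `&` _ = D)//.
by apply/seteqP; split=> [t []|t].
Qed.

Lemma labels_trivIset (B : set K) :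
  trivIset B (fun k => D `&` h @^-1` [set k]).
Proof. by move=> k l _ _ [t [[_ <-] [_ <-]]]. Qed.

Lemma fibre_fin_num k : mu (D `&` h @^-1` [set k]) \is a fin_num.
Proof.
rewrite ge0_fin_numE//; apply: le_lt_trans Dfin.
apply: le_measure; [exact/mem_set/mh| |exact: subIsetl].
exact/mem_set/labels_domain_measurable.
Qed.

Lemma measure_labels (P : pred K) :
  fine (mu (D `&` h @^-1` [set` P])) = \sum_(k | P k) weight D h k.
Proof.
rewrite labels_cover measure_fin_bigcup;
  [|exact: finite_finset|exact: labels_trivIset|move=> k _; exact: mh].
rewrite -(@bigfs _ _ _ _ (index_enum K)) ?index_enum_uniq//; last first.
  by move=> k _; rewrite mem_index_enum.
rewrite (eq_bigr (fun k => (weight D h k)%:E)); last first.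
  by move=> k _; rewrite fineK// fibre_fin_num.
by rewrite sumEFin.
Qed.

Lemma simple_integral_labels (s : {fimfun T >-> Y}) (y : K -> Y) :
  (forall t, D t -> s t = y (h t)) ->
  simple_integral mu D s = \sum_k weight D h k *: y k.
Proof.
move=> sy; rewrite /simple_integral.
have fy : finite_set (range y) by apply: finite_image; exact: finite_finset.
have fibre v : D `&` s @^-1` [set v] = D `&` h @^-1` [set` [pred k | y k == v]].
  apply/seteqP; split=> t [Dt] /=.
    by rewrite /preimage /= sy// => /eqP.
  by rewrite /preimage /= sy// => /eqP.
rewrite (fsbigTE (fset_set (range y))); last first.
  move=> v; rewrite in_fset_set// notin_setE => nv.
  rewrite fibre (_ : _ `&` _ = set0) ?measure0 ?scale0r//.
  by apply/seteqP; split=> // t [_ /eqP yv]; apply: nv; exists (h t).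
under eq_bigr do rewrite fibre measure_labels scaler_suml.
rewrite (exchange_big_dep predT)//=; apply: eq_bigr => k _.
have ykr : y k \in fset_set (range y) by rewrite in_fset_set //; apply: mem_set; exists k.
rewrite big_mkcond (bigD1_seq (y k) ykr (fset_uniq _))/=.
by rewrite eqxx big1 ?addr0// => v /negPf; rewrite eq_sym => ->.
Qed.

Lemma integral_labels (phi : K -> R) : (forall k, 0 <= phi k) ->
  (\int[mu]_(t in D) (phi (h t))%:E = (\sum_k weight D h k * phi k)%:E)%E.
Proof.
move=> phi0.
pose f : T -> \bar R := fun t => (phi (h t))%:E.
have mphi : measurable_fun D f.
  move=> _ B _; rewrite (_ : _ @^-1` B = h @^-1` [set` [pred k | (phi k)%:E \in B]]).
    exact: labels_measurable.
  by apply/seteqP; split=> t /=; [move/mem_set|move/set_mem].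
have DU : D = \big[setU/set0]_(k <- index_enum K) (D `&` h @^-1` [set k]).
  rewrite -bigcup_seq; apply/seteqP; split=> [t Dt|t [k _ []]//].
  by exists (h t) => //=; rewrite mem_index_enum.
rewrite [X in integral mu X _]DU ge0_integral_bigsetU//=; last 4 first.
- exact: index_enum_uniq.
- exact: labels_trivIset.
- by rewrite -DU.
- by move=> t _; rewrite lee_fin.
rewrite -sumEFin; apply: eq_bigr => k _.
rewrite (eq_integral (cst (phi k)%:E)).
  by rewrite integral_cst// EFinM muleC fineK// fibre_fin_num.
by move=> t; rewrite inE => -[_ <-].
Qed.


Lemma simple_integral_labels_dist (s1 s2 : {fimfun T >-> Y}) (y1 y2 : K -> Y) :
  (forall t, D t -> s1 t = y1 (h t)) -> (forall t, D t -> s2 t = y2 (h t)) ->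
  (`|simple_integral mu D s1 - simple_integral mu D s2|%:E <=
   \int[mu]_(t in D) `|s1 t - s2 t|%:E)%E.
Proof.
move=> e1 e2; rewrite (simple_integral_labels e1) (simple_integral_labels e2).
rewrite (eq_integral (fun t => `|y1 (h t) - y2 (h t)|%:E)); last first.
  by move=> t; rewrite inE => Dt; rewrite e1// e2.
rewrite (integral_labels (phi := fun k => `|y1 k - y2 k|))// lee_fin -sumrB.
apply: le_trans (ler_norm_sum _ _ _) _; apply: ler_sum => k _.
by rewrite -scalerBr normrZ ger0_norm// fine_ge0.
Qed.

End FixedLabels.

(** The value, as an element of the finite type that serves as labels. *)
Definition range_label (s : {fimfun T >-> Y}) (t : T) : fset_set (range s) :=
  FSetSub (etrans (in_fset_set (fimfunP s) (s t)) (mem_set (imageP s I))).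

(** Two simple functions are step functions for the same labels, the pairs of
    their values, which reduces the inequality to a finite sum. *)
Lemma simple_integral_dist (D : set T) (s1 s2 : {fimfun T >-> Y}) :
  (mu D < +oo)%E -> simple_on mu D s1 -> simple_on mu D s2 ->
  (`|simple_integral mu D s1 - simple_integral mu D s2|%:E <=
   \int[mu]_(t in D) `|s1 t - s2 t|%:E)%E.
Proof.
move=> Dfin sim1 sim2; pose h t := (range_label s1 t, range_label s2 t).
apply: (@simple_integral_labels_dist _ D h _ Dfin _ _
  (fun k => val k.1) (fun k => val k.2)) => // -[v w].
have -> : D `&` h @^-1` [set (v, w)] =
    (D `&` s1 @^-1` [set val v]) `&` (D `&` s2 @^-1` [set val w]).
  apply/seteqP; split=> t /=; first by move=> [Dt [<- <-]].
  by move=> [[Dt e1] [_ e2]]; split=> //; congr pair; exact: val_inj.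
by apply: measurableI; [case: (sim1 (val v))|case: (sim2 (val w))].
Qed.

(** A simple function is its own approximating sequence.  The integrals along
    any other approximating sequence have the same limit, since they differ
    from that of [s] by at most the integral of the norm of the difference. *)
Lemma bochner_integral_simple (D : set T) (f : T -> Y) (s : {fimfun T >-> Y}) :
  (mu D < +oo)%E -> simple_on mu D s -> (forall t, D t -> f t = s t) ->
  bochner_integrable mu D f /\ bochner_integral mu D f = simple_integral mu D s.
Proof.
move=> Dfin sim fs.
have approx : bochner_approx mu D f (fun=> s).
  split=> //.
    by apply: aeW => t Dt; rewrite fs//; exact: cvg_cst.
  rewrite (_ : (fun _ : nat => _) = cst 0%E); first exact: cvg_cst.
  apply/funext => k; apply: integral0_eq => t Dt.
  by rewrite fs// subrr normr0.
split; first by exists (fun=> s).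
have isI : is_bochner_integral mu D f (simple_integral mu D s).
  by exists (fun=> s) => //; exact: cvg_cst.
rewrite /bochner_integral; case: xgetP => [v _ [s' [sim' _ cvg'] cvgv]|/(_ _ isI)//].
suff cvgs : simple_integral mu D (s' k) @[k --> \oo] --> simple_integral mu D s.
  exact: cvg_unique cvgv cvgs.
have dist0 : (`|simple_integral mu D s - simple_integral mu D (s' k)|%:E)%E
    @[k --> \oo] --> 0%:E.
  apply: squeeze_cvge (cvg_cst _) cvg'; near=> k.
  rewrite lee_fin normr_ge0/= (eq_integral (fun t => `|s t - s' k t|%:E)).
    exact: simple_integral_dist.
  by move=> t; rewrite inE => Dt; rewrite fs.
apply/subr_cvg0; apply/norm_cvg0P.
under eq_fun do rewrite distrC.
exact: (fine_cvg dist0).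
Unshelve. all: by end_near. Qed.

Lemma bochner_integral_labels (K : finType) (D : set T) (h : T -> K)
    (y : K -> Y) (f : T -> Y) :
  measurable_labels D h -> (mu D < +oo)%E -> (forall t, D t -> f t = y (h t)) ->
  bochner_integrable mu D f /\
  bochner_integral mu D f = \sum_k weight D h k *: y k.
Proof.
move=> mh Dfin fy.
have fin_yh : finite_set (range (y \o h)).
  apply: (sub_finite_set (B := range y)); first by move=> _ [t _ <-]; exists (h t).
  by apply: finite_image; exact: finite_finset.
pose s : {fimfun T >-> Y} := HB.pack (y \o h) (FiniteImage.Build _ _ _ fin_yh).
rewrite -(simple_integral_labels mh Dfin (s := s))//.
apply: bochner_integral_simple => // v.
have -> : D `&` s @^-1` [set v] = D `&` h @^-1` [set` [pred k | y k == v]].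
  by apply/seteqP; split=> t [Dt] /eqP.
split; first exact: labels_measurable.
move=> _; apply: le_lt_trans Dfin; apply: le_measure; [| |exact: subIsetl].
  exact/mem_set/labels_measurable.
exact/mem_set/(labels_domain_measurable mh).
Qed.

End LabelledStepFunctions.

(** * The intervals of agents of each type *)

Section TypeIntervals.
Context {R : realType} {n : nat}.
Notation mu := (@lebesgue_measure R).
Implicit Types (i : 'I_n.+1) (t : R).

Lemma agents_of_type_itv i t :
  i%:R / n.+1%:R <= t < i.+1%:R / n.+1%:R -> agents_of_type i t.
Proof.
rewrite /agents_of_type; case: eqP => [->|_] /=; rewrite in_itv//=.
by move=> /andP[-> /ltW]; rewrite divff// pnatr_eq0.
Qed.

Lemma agents_of_type_cover t : agents t -> exists i, agents_of_type i t.
Proof.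
rewrite /agents /= in_itv /= => /andP[t0]; rewrite le_eqVlt => /predU1P[->|t1].
  exists ord_max; rewrite /agents_of_type eqxx /= in_itv /= lexx andbT.
  by rewrite ler_pdivrMr ?ltr0n// mul1r ler_nat.
have N0 : 0 < n.+1%:R :> R by rewrite ltr0n.
have := truncn_itv (mulr_ge0 t0 (ltW N0)); set k := Num.truncn _ => /andP[kt tk].
have kn : (k < n.+1)%N.
  by rewrite -(ltr_nat R) (le_lt_trans kt)// -[ltRHS]mul1r ltr_pM2r.
exists (Ordinal kn); apply: agents_of_type_itv.
by rewrite ler_pdivrMr// ltr_pdivlMr// kt.
Qed.

Lemma agents_of_type_sub i : agents_of_type i `<=` @agents R.
Proof.
move=> t; rewrite /agents_of_type /agents; case: eqP => _ /=; rewrite !in_itv /=.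
  by move=> /andP[+ ->]; rewrite andbT; apply: le_trans; rewrite divr_ge0.
move=> /andP[it ti]; rewrite (le_trans _ it) ?divr_ge0//=.
by rewrite (le_trans (ltW ti))// ler_pdivrMr ?ltr0n// mul1r ler_nat.
Qed.

Lemma agents_type_fibre i :
  agents `&` @agent_type R n @^-1` [set i] = agents_of_type i.
Proof.
apply/seteqP; split=> [t [/agents_of_type_cover[j jt] <-]|t it].
  by rewrite /= (agent_typeP jt).
by split; [exact: agents_of_type_sub it|exact: agent_typeP].
Qed.

Lemma agents_of_type_measurable i : measurable (agents_of_type i : set R).
Proof. by rewrite /agents_of_type; case: ifP => _; exact: measurable_itv. Qed.

Lemma agents_of_type_measure i :
  mu (agents_of_type i : set R) = (n.+1%:R^-1)%:E.
Proof.
have N0 : 0 < n.+1%:R^-1 :> R by rewrite invr_gt0 ltr0n.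
have e : i.+1%:R / n.+1%:R = i%:R / n.+1%:R + n.+1%:R^-1 :> R.
  by rewrite -natr1 mulrDl mul1r.
have {e} itv_len (b : R) : b = i.+1%:R / n.+1%:R -> (i%:R / n.+1%:R < b) *
    (b - i%:R / n.+1%:R = n.+1%:R^-1).
  by rewrite e => ->; rewrite ltrDl N0 addrAC subrr add0r.
rewrite /agents_of_type; case: eqP => [im|_];
  rewrite lebesgue_measure_itv/= lte_fin -EFinD.
  by rewrite !itv_len// im divff// pnatr_eq0.
by rewrite !itv_len.
Qed.

Lemma agents_fin : (mu (agents : set R) < +oo)%E.
Proof. by rewrite lebesgue_measure_itv/= lte_fin ltr01 -EFinD ltry. Qed.

End TypeIntervals.

(** * Disjoint sets of agents with prescribed measures *)

Section DisjointPieces.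
Context {R : realType} {n : nat} (K : finType) (tau : K -> 'I_n.+1) (lam : K -> R).
Hypotheses (lam0 : forall k, 0 <= lam k) (lam1 : \sum_k lam k <= n.+1%:R^-1).
Notation mu := (@lebesgue_measure R).

Let cum r := \sum_(j | (enum_rank j < r)%N) lam j.

Let cum_le r s : (r <= s)%N -> cum r <= cum s.
Proof.
move=> rs; rewrite /cum [leRHS](bigID (fun j => (enum_rank j < r)%N))/=.
rewrite [X in X + _](eq_bigl (fun j => (enum_rank j < r)%N)).
  by rewrite lerDl sumr_ge0.
by move=> j; case: (ltnP (enum_rank j) r) => [jr|]; rewrite ?andbF// (leq_trans jr).
Qed.

Let cumS k : cum (enum_rank k).+1 = cum (enum_rank k) + lam k.
Proof.
rewrite /cum (bigD1 k)//= addrC; congr (_ + _); apply: eq_bigl => j.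
rewrite ltnS ltn_neqAle andbC; congr (_ && _).
by rewrite (inj_eq val_inj) (inj_eq enum_rank_inj).
Qed.

Let cum0 r : 0 <= cum r.
Proof. by apply: sumr_ge0. Qed.

Let cum_max r : cum r <= n.+1%:R^-1.
Proof.
apply: le_trans lam1; rewrite /cum [leRHS](bigID (fun j => (enum_rank j < r)%N))/=.
by rewrite lerDl sumr_ge0.
Qed.

Let piece k : set R := `[(tau k)%:R / n.+1%:R + cum (enum_rank k),
                         (tau k)%:R / n.+1%:R + cum (enum_rank k).+1[%classic.

(** The piece [k] occupies, in the interval of type [tau k], the positions
    between the cumulated weights before and after [k].  Positions of different
    pieces do not overlap, and all pieces fit because the total weight is at
    most the common length of the type intervals. *)
Lemma disjoint_pieces : exists S : K -> set R,
  [/\ forall k, measurable (S k), forall k, S k `<=` agents_of_type (tau k),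
      forall t k l, S k t -> S l t -> k = l &
      forall k, mu (S k) = (lam k)%:E].
Proof.
have pieceS k : piece k `<=` agents_of_type (tau k).
  move=> t; rewrite /piece /= in_itv/= => /andP[kt tk]; apply: agents_of_type_itv.
  rewrite (le_trans _ kt) ?lerDl ?cum0//= (lt_le_trans tk)//.
  by rewrite -[(tau k).+1%:R]natr1 mulrDl mul1r lerD2l cum_max.
exists piece; split=> //.
- by move=> k; exact: measurable_itv.
- have ltF t k l : piece k t -> piece l t -> ~ (enum_rank k < enum_rank l)%N.
    move=> kt lt kl; have tkl : tau k = tau l.
      by rewrite -(agent_typeP (pieceS _ _ kt)) (agent_typeP (pieceS _ _ lt)).
    move: kt lt; rewrite /piece /= !in_itv/= tkl => /andP[_ t1] /andP[t2 _].
    have := le_lt_trans t2 t1; rewrite ltrD2l ltNge => /negP; apply.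
    exact: cum_le.
  move=> t k l kt lt; apply: enum_rank_inj; apply: val_inj.
  case: (ltngtP (val (enum_rank k)) (val (enum_rank l))) => // [kl|lk].
    by case: (ltF t k l kt lt kl).
  by case: (ltF t l k lt kt lk).
- move=> k; rewrite /piece lebesgue_measure_itv/= lte_fin cumS.
  have [l0|l0] := ltP 0 (lam k).
    by rewrite ltrD2l ltrDl l0 -EFinD addrA [X in X - _]addrC addrK.
  by rewrite ltrD2l ltrDl ltNge l0/=; congr EFin; apply/le_anti; rewrite lam0 l0.
Qed.
End DisjointPieces.

(** * Positive cones, and coalitions that block *)

Section BanachLatticeCone.
Context {R : realType} {Y : banachLatticeType R}.
Implicit Types (x y u : Y).

Lemma vle_sub x y : x <=^v y <-> positive_cone Y (y - x).
Proof.
split=> [/(vleD2r (- x))|/(vleD2r x)]; first by rewrite subrr.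
by rewrite add0r subrK.
Qed.

Lemma positive_convex_cone : convex_cone (positive_cone Y).
Proof.
split=> [|x y x0 y0|c x c0]; first exact: vle_refl.
  apply: vle_trans y0 _; rewrite -{1}[y]add0r; exact: vleD2r.
by move=> /(vleZ2l _ _ _ c0); rewrite scaler0.
Qed.

Lemma positive_sum (I : Type) (r : seq I) (P : pred I) (y : I -> Y) :
  (forall i, P i -> positive_cone Y (y i)) ->
  positive_cone Y (\sum_(i <- r | P i) y i).
Proof. by have [C0 CD _] := positive_convex_cone; move=> y0; elim/big_ind: _. Qed.

Lemma positive_pointed y : positive_cone Y y -> positive_cone Y (- y) -> y = 0.
Proof.
move=> y0 Ny0; apply: vle_anti; apply/andP; split=> //.
by apply/vle_sub; rewrite sub0r.
Qed.

Lemma interior_cone_ball u : interior (positive_cone Y) u ->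
  exists2 e : R, 0 < e & forall y, `|y| <= e -> positive_cone Y (u + y).
Proof.
move=> /nbhs_ballP[e /= e0 eu]; exists (e / 2); first by rewrite divr_gt0.
move=> y ye; apply: eu; rewrite -ball_normE /ball_ /= opprD addrA subrr sub0r normrN.
by rewrite (le_lt_trans ye)// ltr_pdivrMr// mulr2n mulrDr mulr1 ltrDl.
Qed.

(** The vector [y], rescaled to the radius of a ball around [u] inside the cone,
    may be subtracted from [u]. *)
Lemma interior_order_unit u y : interior (positive_cone Y) u ->
  exists2 a : R, 0 <= a & positive_cone Y (a *: u - y).
Proof.
move=> /interior_cone_ball[e e0 eu]; exists (`|y| / e).
  by rewrite divr_ge0// ltW.
have [->|y0] := eqVneq y 0.
  by rewrite normr0 mul0r scale0r subr0; exact: vle_refl.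
have ny : 0 < `|y| by rewrite normr_gt0.
have [_ _ CZ] := positive_convex_cone.
have -> : (`|y| / e) *: u - y = (`|y| / e) *: (u - (e / `|y|) *: y).
  by rewrite scalerBr scalerA mulrA divfK ?gt_eqF// divff ?gt_eqF// scale1r.
apply: CZ; first by rewrite divr_ge0// ltW.
apply: eu; rewrite normrN normrZ ger0_norm ?divr_ge0 ?(ltW e0)//.
by rewrite divfK ?gt_eqF.
Qed.

Lemma positive_linear_mono (p : {linear Y -> R^o}) x y :
  (forall z, positive_cone Y z -> 0 <= p z) -> x <=^v y -> p x <= p y.
Proof. by move=> p0 /vle_sub /p0; rewrite linearB subr_ge0. Qed.

(** A small ball around [0] lies between [- u] and [u], so [p] is bounded on it. *)
Lemma positive_linear_continuous (p : {linear Y -> R^o}) :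
  (exists u, interior (positive_cone Y) u) ->
  (forall z, positive_cone Y z -> 0 <= p z) -> continuous p.
Proof.
move=> [u /interior_cone_ball[e e0 eu]] p0.
apply: bounded_linear_continuous; apply/ex_bound; exists (p u).
apply/nbhs_norm0P; exists e => //= y /ltW ye.
have /p0 puy := eu _ ye.
have /p0 : positive_cone Y (u - y) by apply: eu; rewrite normrN.
by move: puy; rewrite linearB linearD/= ler_norml; lra.
Qed.

End BanachLatticeCone.

Section Trades.
Context {R : realType} {Omega : finType} {F : set (set Omega)}
        {Y : banachLatticeType R} {n : nat} (E : economy F Y n).
Context (f : R -> Omega -> Y) (x : 'I_n.+1 -> Omega -> Y).
Hypothesis hfx : forall i t, agents_of_type i t -> f t = x i.
Notation mu := (@lebesgue_measure R).

Definition improves i (z : Omega -> Y) : Prop :=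
  consumption E i z /\ expected_utility E i (x i) < expected_utility E i z.

(** Up to a common factor the weights [c k] are the measures of disjoint sets
    of agents of type [tau k].  The union of these sets, on which the [k]-th one
    consumes [z k], would be a blocking coalition. *)
Lemma core_no_dominated_trades (K : finType) (c : K -> R) (tau : K -> 'I_n.+1)
    (z : K -> Omega -> Y) : private_core E f ->
  (forall k, 0 <= c k) -> 0 < \sum_k c k -> (forall k, improves (tau k) (z k)) ->
  ~ forall w, \sum_k c k *: (z k w - endowment E (tau k) w) <=^v 0.
Proof.
move=> [_ _ noblock] c0 c1 zP trade0.
(* [k0] gives the coalition a positive measure, and a default label. *)
have [k0 ck0] : exists k0, 0 < c k0.
  apply: contrapT => nk; move: c1; rewrite big1 ?ltxx// => k _.
  by apply/le_anti; rewrite c0 andbT leNgt; apply/negP => ck; apply: nk; exists k.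
pose lam k := c k / ((\sum_j c j) * n.+1%:R).
have N0 : 0 < n.+1%:R :> R by rewrite ltr0n.
have [||S [mS Stau Sinj muS]] := @disjoint_pieces R n K tau lam.
- by move=> k; rewrite divr_ge0// mulr_ge0// ltW.
- by rewrite -mulr_suml invfM mulrA divff ?gt_eqF// mul1r.
pose U := \bigcup_k S k.
pose h t := odflt k0 [pick k | t \in S k].
have hS k t : S k t -> h t = k.
  move=> Skt; rewrite /h; case: pickP => [j /set_mem Sjt|/(_ k)] /=.
    exact: Sinj Sjt Skt.
  by rewrite mem_set.
have fibre k : U `&` h @^-1` [set k] = S k.
  apply/seteqP; split=> [t [[j _ Sjt] <-]|t Skt]; first by rewrite (hS j).
  by split; [exists k|exact: hS].
have mh : measurable_labels U h by move=> k; rewrite fibre.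
have Uagents : U `<=` agents.
  by move=> t [k _ /Stau]; exact: agents_of_type_sub.
have mU := labels_domain_measurable mh.
have Ufin : (mu U < +oo)%E.
  apply: le_lt_trans (@agents_fin R); apply: le_measure => //; apply: mem_set => //.
  exact: measurable_itv.
have hw k : weight mu U h k = lam k.
  by rewrite /weight fibre -[RHS]/(fine (lam k)%:E) -muS.
have type_of t : U t -> agent_type t = tau (h t) /\ f t = x (tau (h t)).
  move=> [k _ Skt]; rewrite (hS _ _ Skt) (agent_typeP (Stau _ _ Skt)).
  by rewrite (hfx (Stau _ _ Skt)).
have zI w := bochner_integral_labels (mu := mu) (y := fun k => z k w) mh Ufin
  (fun _ _ => erefl).
apply: (noblock U).
  split=> //; apply: (@lt_le_trans _ _ (mu (S k0))).
    by rewrite muS lte_fin divr_gt0// mulr_gt0.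
  by apply: le_measure; [exact: (mem_set (mS k0))|exact: (mem_set mU)|];
    move=> t; exists k0.
exists (fun t => z (h t)); split.
- split=> [t w Ut|w]; first by case: (zP (h t)) => -[].
  by have [] := zI w.
- by move=> t /type_of[et _]; rewrite /consumption_c et; case: (zP (h t)).
- by move=> t /type_of[et ->]; rewrite /expected_utility_c et; case: (zP (h t)).
move=> w.
have [_ ->] := zI w.
have [|_ ->] := bochner_integral_labels (mu := mu) (f := endowment_c E ^~ w)
    (y := fun k => endowment E (tau k) w) mh Ufin.
  by move=> t /type_of[et _]; rewrite /endowment_c et.
have [_ _ CZ] := @positive_convex_cone _ Y.
apply/vle_sub; rewrite -sumrB.
rewrite (_ : \sum_k _ = ((\sum_j c j) * n.+1%:R)^-1 *:
    (0 - \sum_k c k *: (z k w - endowment E (tau k) w))).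
  apply: CZ; first by rewrite invr_ge0 mulr_ge0// ltW.
  exact: (iffLR (vle_sub _ _) (trade0 w)).
rewrite sub0r -sumrN scaler_sumr; apply: eq_bigr => k _.
by rewrite !hw -scalerBr -scalerN opprB scalerA mulrC.
Qed.

End Trades.

(** * Averaging prices over the atoms of the state space *)

Section InformationAtoms.
Context {Omega : finType} (F : set (set Omega)).

(** Points that no set of [F] separates; the classes are the atoms of [F] when
    [F] is a sigma-algebra. *)
Definition same_atom (w w' : Omega) : bool := `[< forall A, F A -> A w <-> A w' >].

Lemma same_atom_refl : reflexive same_atom.
Proof. by move=> w; apply/asboolP. Qed.

Lemma same_atom_sym : symmetric same_atom.
Proof.
by move=> w w'; apply/asboolP/asboolP => ww' A FA; apply: iff_sym; exact: ww'.
Qed.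

Lemma same_atom_trans : transitive same_atom.
Proof.
move=> v w u /asboolP wv /asboolP vu; apply/asboolP => A FA.
exact: iff_trans (wv A FA) (vu A FA).
Qed.

(** Since the state space is finite, such a set is a finite union of finite
    intersections of sets of [F] that separate a point of [A] from a point
    outside [A]. *)
Lemma saturated_measurable (A : set Omega) : sigma_algebra [set: Omega] F ->
  (forall w w', same_atom w w' -> A w -> A w') -> F A.
Proof.
move=> [F0 FCT FU] satA.
have FC B : F B -> F (~` B) by rewrite -setTD; exact: FCT.
have F_bigcup (B : Omega -> set Omega) : (forall w, F (B w)) -> F (\bigcup_w B w).
  move=> FB; have -> : \bigcup_w B w = \bigcup_k oapp B set0 (choice.unpickle k).
    apply/seteqP; split=> [v [w _ Bv]|v [k _]].
      by exists (choice.pickle w) => //; rewrite choice.pickleK.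
    by case: choice.unpickle => //= w Bv; exists w.
  by apply: FU => k; case: choice.unpickle.
have sep w w' : exists B, [/\ F B, A w -> B w & B w' -> A w'].
  have [Aw'|nAw'] := pselect (A w').
    by exists (~` set0); split; [exact: FC F0|move=> _ []|].
  have [Aw|nAw] := pselect (A w); last by exists set0.
  have : ~~ same_atom w w' by apply: contra_notN nAw' => /satA; exact.
  move=> /asboolPn/existsNP[B /not_implyP[FB nB]].
  have [Bw|nBw] := pselect (B w).
    by exists B; split=> // Bw'; exfalso; apply: nB.
  exists (~` B); split=> //; first exact: FC.
  by move=> nBw'; exfalso; apply: nB.
have [B BP] := choice (fun ww' : Omega * Omega => sep ww'.1 ww'.2).
have -> : A = \bigcup_w ~` (\bigcup_w' ~` B (w, w')).
  apply/seteqP; split=> [w Aw|w' [w _ Bw']].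
    by exists w => // -[w' _]; apply; case: (BP (w, w')) => _ + _; exact.
  have [_ _] := BP (w, w'); apply; apply: contrapT => nBw'.
  by apply: Bw'; exists w'.
apply: (F_bigcup) => w; apply: (FC); apply: F_bigcup => w'; apply: FC.
by case: (BP (w, w')).
Qed.

End InformationAtoms.

Section AveragedPrice.
Context {R : realType} {Omega : finType} (F : set (set Omega)) {Y : banachLatticeType R}.
Variable p : {linear (Omega -> Y) -> R^o}.

Definition atom_size (w : Omega) : nat := #|[pred w' | same_atom F w w']|.

(** [spread w y] is [y] at state [w] averaged over the atom of [w]. *)
Definition spread (w : Omega) (y : Y) : Omega -> Y :=
  fun w' => if same_atom F w w' then (atom_size w)%:R^-1 *: y else 0.

Definition averaged_price_fun (w : Omega) (y : Y) : R^o := p (spread w y).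

Fact averaged_price_linear (w : Omega) : linear (averaged_price_fun w).
Proof.
move=> c y z; rewrite /averaged_price_fun -linearP; congr (p _); apply/funext => w'.
rewrite /spread /=; transitivity (c *: spread w y w' + spread w z w'); last by [].
rewrite /spread; case: ifP => _; last by rewrite scaler0 addr0.
by rewrite scalerDr !scalerA mulrC.
Qed.

Definition averaged_price (w : Omega) : {linear Y -> R^o} :=
  HB.pack (averaged_price_fun w)
    (GRing.isLinear.Build _ _ _ _ _ (averaged_price_linear w)).

Lemma same_atomE w w' : same_atom F w w' -> same_atom F w =1 same_atom F w'.
Proof.
move=> ww' v; apply/idP/idP; last exact: same_atom_trans.
by apply: same_atom_trans; rewrite same_atom_sym.
Qed.

Lemma averaged_price_atom w w' : same_atom F w w' ->
  averaged_price w = averaged_price w' :> (Y -> R).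
Proof.
move=> ww'; apply/funext => y; congr (p _); apply/funext => v.
by rewrite /spread /atom_size (same_atomE ww') (eq_card (same_atomE ww')).
Qed.

(** The functions [spread w (v w)] add up to [v], because each state of an atom
    receives as many equal shares as the atom has points. *)
Lemma averaged_price_value (v : Omega -> Y) :
  (forall w w', same_atom F w w' -> v w = v w') -> value averaged_price v = p v.
Proof.
move=> vF; rewrite /value /= -linear_sum; congr (p _); apply/funext => w'.
rewrite fct_sumE /spread -big_mkcond/=.
rewrite (eq_bigr (fun=> (atom_size w')%:R^-1 *: v w')); last first.
  move=> w ww'; rewrite (vF _ _ ww') /atom_size.
  by rewrite (eq_card (same_atomE ww')).
rewrite (eq_bigl (fun w => same_atom F w' w)) => [|w]; last by rewrite same_atom_sym.
rewrite sumr_const scalerMnl -mulr_natl -/(atom_size w') mulfV ?scale1r//.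
by rewrite pnatr_eq0 -lt0n; apply/card_gt0P; exists w'; exact: same_atom_refl.
Qed.

Lemma averaged_price_positive (w : Omega) (y : Y) :
  (forall v : Omega -> Y, (forall w, positive_cone Y (v w)) -> 0 <= p v) ->
  positive_cone Y y -> 0 <= averaged_price w y.
Proof.
have [C0 _ CZ] := @positive_convex_cone _ Y.
move=> p0 y0; apply: p0 => w'; rewrite /spread; case: ifP => // _.
by apply: CZ => //; rewrite invr_ge0.
Qed.

End AveragedPrice.

(** * The supporting price *)

Section SupportingPrice.
Context {R : realType} {Omega : finType} {F : set (set Omega)}
        {Y : banachLatticeType R} {n : nat} (E : economy F Y n).
Context (x : 'I_n.+1 -> Omega -> Y).
Hypothesis hx : forall i, consumption E i (x i).

Lemma exists_state : exists w : Omega, w \in Omega.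
Proof.
apply/card_gt0P; rewrite lt0n; apply: contraTneq isT => O0.
have /eqP := prior_sum1 E ord0; rewrite big1 => [|w _].
  by rewrite eq_sym oner_eq0.
by have := fintype0 w O0.
Qed.

(** The index set of the combination is an arbitrary finite type, so that sums
    of two such functions are indexed by the sum of the index types. *)
Definition trade_cone : set (Omega -> Y) := [set v |
  exists (K : finType) (c : K -> R) (tau : K -> 'I_n.+1) (z : K -> Omega -> Y),
    [/\ forall k, 0 <= c k, forall k, improves E x (tau k) (z k) &
    forall w, \sum_k c k *: (z k w - endowment E (tau k) w) <=^v v w]].

Lemma trade_cone_convex : convex_cone trade_cone.
Proof.
have [C0 CD CZ] := @positive_convex_cone _ Y.
split.
- exists void, (fun=> 0), (fun=> ord0), (fun=> 0); split=> [[]|[]|w].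
  by rewrite big1 => [|[]]; exact: vle_refl.
- move=> v v' [K [c [tau [z [c0 zP zv]]]]] [K' [c' [tau' [z' [c'0 z'P z'v']]]]].
  pose both T (a : K -> T) (b : K' -> T) (k : K + K') :=
    match k with inl k => a k | inr k => b k end.
  exists (K + K')%type, (both _ c c'), (both _ tau tau'), (both _ z z').
  split=> [[]|[]|w]//=.
  rewrite big_sumType/=; apply/vle_sub; rewrite opprD addrACA.
  apply: CD; first exact: (iffLR (vle_sub _ _) (zv w)).
  exact: (iffLR (vle_sub _ _) (z'v' w)).
- move=> a v a0 [K [c [tau [z [c0 zP zv]]]]].
  exists K, (fun k => a * c k), tau, z; split=> // [k|w]; first exact: mulr_ge0.
  under eq_bigr do rewrite -scalerA.
  by rewrite -scaler_sumr; exact: vleZ2l.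
Qed.

Lemma trade_cone_improves i z : improves E x i z ->
  trade_cone (z - endowment E i).
Proof.
move=> zP; exists unit, (fun=> 1), (fun=> i), (fun=> z); split=> // w.
by rewrite big_const card_unit/= addr0 scale1r; exact: vle_refl.
Qed.

Lemma trade_cone_positive (v : Omega -> Y) :
  (forall w, positive_cone Y (v w)) -> trade_cone v.
Proof.
move=> v0; exists void, (fun=> 0), (fun=> ord0), (fun=> 0); split=> [[]|[]|w].
by rewrite big1 => [|[]]; exact: v0.
Qed.

Lemma interior_cone_neq0 (u : Y) : (exists y : Y, y != 0) ->
  interior (positive_cone Y) u -> u != 0.
Proof.
move=> [y y0] ui; apply: contraNneq y0 => u0; apply/eqP.
apply: positive_pointed.
  by have [a _] := interior_order_unit (- y) ui; rewrite u0 scaler0 sub0r opprK.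
by have [a _] := interior_order_unit y ui; rewrite u0 scaler0 sub0r.
Qed.

(** With weights that are all zero, [- u] in the cone would make [u] both
    nonnegative and nonpositive; other weights contradict the core property. *)
Lemma supporting_price (f : R -> Omega -> Y) (u : Y) :
  (exists y : Y, y != 0) -> interior (positive_cone Y) u ->
  (forall i t, agents_of_type i t -> f t = x i) -> private_core E f ->
  exists p : {linear (Omega -> Y) -> R^o}, [/\ p (fun=> u) = 1,
    forall v, (forall w, positive_cone Y (v w)) -> 0 <= p v &
    forall i z, improves E x i z -> p (endowment E i) <= p z].
Proof.
move=> Y0 ui hfx hcore; have [C0 CD CZ] := @positive_convex_cone _ Y.
have u0 : positive_cone Y u := interior_subset ui.
have un0 : u != 0 := interior_cone_neq0 Y0 ui.
have Nu : ~ trade_cone (- ((fun=> u) : Omega -> Y)).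
  move=> [K [c [tau [z [c0 zP zu]]]]].
  have : 0 <= \sum_k c k by apply: sumr_ge0.
  rewrite le_eqVlt => /predU1P[/esym/(psumr_eq0P (fun k _ => c0 k)) cz|cpos].
    have [w _] := exists_state; have := zu w; rewrite big1 => [/vle_sub|k _].
      rewrite subr0 => Nu; move/eqP: un0; apply; exact: positive_pointed.
    by rewrite cz// scale0r.
  apply: (core_no_dominated_trades hfx hcore c0 cpos zP) => w.
  by apply: vle_trans (zu w) _; apply/vle_sub; rewrite sub0r opprK.
have unit_u (v : Omega -> Y) : exists2 a : R, 0 <= a & trade_cone (a *: (fun=> u) - v).
  have /choice[a aP] w : exists b : R, 0 <= b /\ positive_cone Y (b *: u - v w).
    by have [b b0 bP] := interior_order_unit (v w) ui; exists b.
  exists (\sum_w a w); first by apply: sumr_ge0 => w _; case: (aP w).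
  apply: trade_cone_positive => w; rewrite (bigD1 w)//=.
  have -> : ((a w + \sum_(j | j != w) a j) *: (fun=> u) - v) w =
      (a w *: u - v w) + (\sum_(j | j != w) a j) *: u.
    transitivity ((a w + \sum_(j | j != w) a j) *: u - v w) => //.
    by rewrite scalerDl addrAC.
  apply: CD; first by case: (aP w).
  by apply: CZ => //; apply: sumr_ge0 => j _; case: (aP j).
have [p [pu p0]] := cone_separation trade_cone_convex Nu unit_u.
exists p; split=> // [v v0|i z /trade_cone_improves/p0].
  exact/p0/trade_cone_positive.
by rewrite linearB subr_ge0.
Qed.

End SupportingPrice.

(** * Budgets, demand and wealth *)

Section QuasiInterior.
Context {R : realType} {Y : banachLatticeType R}.

(** The ideal of [a] is dense, so it contains a point [z] close enough to
    [u + u] to dominate [u]; as [z] is at most a multiple of [a], the price of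
    [u] is at most a multiple of the price of [a]. *)
Lemma quasi_interior_price (p : {linear Y -> R^o}) (a u : Y) :
  (forall y, positive_cone Y y -> 0 <= p y) -> interior (positive_cone Y) u ->
  quasi_interior a -> p a <= 0 -> p u <= 0.
Proof.
move=> p0 ui [a0 a_dense] pa.
have [e e0 eu] := interior_cone_ball ui.
have [z [uz [m zm]]] : exists z, ball (u + u) e z /\ principal_ideal a z.
  apply: a_dense; last exact: ball_open.
  by exists (u + u); exact: ballxx.
have vle_abs (y : Y) : y <=^v vabs y.
  by have := vsup_vle y (- y) (vabs y); rewrite vle_refl => /esym/andP[].
have abs_a : vabs a <=^v a.
  rewrite vsup_vle vle_refl/=; apply: vle_trans (a0).
  by apply/vle_sub; rewrite sub0r opprK.
have [C0 CD CZ] := @positive_convex_cone _ Y.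
have le_uz : u <=^v z.
  apply/vle_sub; have -> : z - u = u + (z - (u + u)).
    by rewrite addrCA opprD addNKr.
  apply: eu; move: uz; rewrite -ball_normE /ball_ /= distrC; exact: ltW.
have le_zma : z <=^v a *+ m.
  apply: vle_trans (vle_abs z) _; apply: vle_trans zm _.
  apply/vle_sub; rewrite -mulrnBl -scaler_nat; apply: CZ => //.
  exact: (iffLR (vle_sub _ _) abs_a).
apply: le_trans (positive_linear_mono p0 le_uz) _.
apply: le_trans (positive_linear_mono p0 le_zma) _.
by rewrite linearMn/= mulrn_wle0.
Qed.

End QuasiInterior.

Section Equilibrium.
Context {R : realType} {Omega : finType} {F : set (set Omega)}
        {Y : banachLatticeType R} {n : nat} (E : economy F Y n).
Implicit Types (i : 'I_n.+1) (z : Omega -> Y).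

Lemma info_measurable_same_atom i z w w' :
  info_measurable E i z -> same_atom F w w' -> z w = z w'.
Proof.
move=> zE /asboolP ww'.
have : w \in finset.cover (info E i).
  by rewrite (finset.cover_partition (info_partition E i)) inE.
move=> /finset.bigcupP[B BE wB].
by apply: (zE B) => //; apply: (iffLR (ww' _ (info_event BE))).
Qed.

(** Along [r -> 1] from below, [r *: z] stays in the cone and tends to [z], so
    its expected utility eventually exceeds that of [x i]. *)
Lemma improves_scale (x : 'I_n.+1 -> Omega -> Y) i z : continuous_utility E ->
  improves E x i z -> exists r : R, [/\ 0 < r, r < 1 & improves E x i (r *: z)].
Proof.
move=> contU [[z0 zi] xz]; have [C0 CD CZ] := @positive_convex_cone _ Y.
have cvgV : expected_utility E i (r *: z) @[r --> (1 : R)^'-] -->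
    expected_utility E i z.
  apply: cvg_big => [|w _]; first exact: add_continuous.
  apply: cvgMr_tmp.
  have cz : r *: z w @[r --> (1 : R)^'-] --> z w.
    rewrite -[X in _ --> X]scale1r; apply: cvgZr_tmp.
    exact: cvg_at_left_filter cvg_id.
  have /subspace_continuousP/(_ (z w) (z0 w)) cU := contU i w.
  apply: (cvg_comp (fun r : R => r *: z w) (utility E i w) _ cU) => P.
  rewrite /within /= => /cz; rewrite /nbhs /=.
  apply: filterS2 (nbhs_left_gt (ltr01 : (0 : R) < 1)) => r r0; apply.
  by apply: CZ; [exact: ltW|exact: z0].
have [r [/andP[r0 r1] xr]] : exists r : R, (0 < r < 1) /\
    expected_utility E i (x i) < expected_utility E i (r *: z).
  near (1 : R)^'- => r; exists r; split; last by near: r; exact: cvgr_gt cvgV _ xz.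
  by apply/andP; split; near: r; [exact: nbhs_left_gt|exact: nbhs_left_lt].
exists r; split=> //; split=> //; split=> [w|B BE w w' wB w'B].
  by apply: CZ; [exact: ltW|exact: z0].
by congr (r *: _); exact: zi wB w'B.
Unshelve. all: by end_near. Qed.

Lemma improves_add (x : 'I_n.+1 -> Omega -> Y) i (y : Y) : monotone_utility E ->
  consumption E i (x i) -> 0 <^v y -> improves E x i (x i + (fun=> y)).
Proof.
move=> mono [x0 xi] y0; have [C0 CD CZ] := @positive_convex_cone _ Y.
split; first split=> [w|B BE w w' wB w'B].
- by apply: CD => //; case/andP: y0.
- by congr (_ + _); exact: xi wB w'B.
apply: ltr_sum => [|w _]; last by rewrite ltr_pM2r ?prior_gt0//; exact: mono.
by have [w _] := exists_state E; apply/hasP; exists w; rewrite ?mem_index_enum.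
Qed.

Lemma value_linear_comb (pi : Omega -> {linear Y -> R^o}) (c : 'I_n.+1 -> R)
    (z : 'I_n.+1 -> Omega -> Y) :
  value pi (fun w => \sum_i c i *: z i w) = \sum_i c i * value pi (z i).
Proof.
rewrite /value; under eq_bigr do rewrite linear_sum.
rewrite exchange_big/=; apply: eq_bigr => i _; rewrite mulr_sumr.
by apply: eq_bigr => w _; rewrite linearZ.
Qed.

Lemma agents_bochner_integral (f : R -> Omega -> Y) (x : 'I_n.+1 -> Omega -> Y) w :
  (forall i t, agents_of_type i t -> f t = x i) ->
  bochner_integral (@lebesgue_measure R) agents (f ^~ w) =
  \sum_i n.+1%:R^-1 *: x i w.
Proof.
move=> hfx.
have mh : measurable_labels (@agents R) (@agent_type R n).
  by move=> i; rewrite agents_type_fibre; exact: agents_of_type_measurable.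
have [|_ ->] := bochner_integral_labels (mu := @lebesgue_measure R) (f := f ^~ w)
    (y := fun i => x i w) mh agents_fin.
  move=> t tA; have [i it] := agents_of_type_cover (n := n) tA.
  by rewrite (hfx i t it) (agent_typeP it).
apply: eq_bigr => i _; congr (_ *: _).
rewrite /weight agents_type_fibre -[RHS]/(fine n.+1%:R^-1%:E).
by rewrite -(agents_of_type_measure i).
Qed.

(** The constraint holds for almost all agents, and the agents of type [i] form a
    set of positive measure. *)
Lemma allocation_consumption (f : R -> Omega -> Y) (x : 'I_n.+1 -> Omega -> Y) i :
  (forall i t, agents_of_type i t -> f t = x i) -> allocation E f ->
  consumption E i (x i).
Proof.
move=> hfx [_ aeC]; apply: contrapT => nC.
have N0 : (0 < (n.+1%:R^-1 : R)%:E)%E by rewrite lte_fin invr_gt0 ltr0n.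
move: N0; rewrite -(agents_of_type_measure i) measure_negligible ?ltxx//.
  exact: agents_of_type_measurable.
apply: negligibleS aeC => t it /= /(_ (agents_of_type_sub it)).
by rewrite /consumption_c (agent_typeP it) (hfx _ _ it).
Qed.

End Equilibrium.

(** * Existence of the equilibrium price *)

Theorem theorem3p1 (R : realType) (Omega : finType) (F : set (set Omega))
    (hF : sigma_algebra [set: Omega] F)
    (Y : banachLatticeType R) (hY : exists y : Y, y != 0)
    (n : nat) (E : economy F Y n)
    (hint : exists u : Y, interior (positive_cone Y) u)
    (hcont : continuous_utility E)
    (hmono : monotone_utility E)
    (hquasi : quasi_interior_endowment E)
    (f : R -> Omega -> Y) (x : 'I_n.+1 -> Omega -> Y)
    (hf : allocation E f) (hfeas : feasible_on E agents f)
    (hfx : forall i t, agents_of_type i t -> f t = x i)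
    (hcore : private_core E f) :
  exists pi : Omega -> {linear Y -> R^o},
    quasi_equilibrium E f pi /\ nontrivial_price E pi.
Proof.
have [u ui] := hint.
have hx i : consumption E i (x i) := allocation_consumption i hfx hf.
have [p [pu p_ge0 p_improves]] := supporting_price hY ui hfx hcore.
have u0 : 0 <^v u.
  by rewrite eq_sym interior_cone_neq0// andbT; exact: interior_subset ui.
pose pi := averaged_price F p.
have value_info i z : info_measurable E i z -> value pi z = p z.
  by move=> zE; apply: averaged_price_value => w w'; exact: info_measurable_same_atom zE.
have value_u : value pi (fun=> u) = 1 by rewrite averaged_price_value.
have aE i : info_measurable E i (endowment E i) by move=> B; exact: endowment_info.
have pi_pos w y : positive_cone Y y -> 0 <= pi w y.
  by move=> y0; exact: averaged_price_positive p_ge0 y0.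
have hfa i t : agents_of_type i t -> endowment_c E t = endowment E i.
  by move=> it; rewrite /endowment_c (agent_typeP it).
have feasE w : \sum_i x i w <=^v \sum_i endowment E i w.
  have := hfeas w.
  rewrite (agents_bochner_integral _ hfx) (agents_bochner_integral _ hfa).
  rewrite -!scaler_sumr => /(vleZ2l _ _ _ (ler0n R n.+1)).
  by rewrite !scalerA divff ?pnatr_eq0// !scale1r.
(* [e *: u] costs [e], and adding it to [x i] gives an improving bundle. *)
have le_ax i : p (endowment E i) <= p (x i).
  apply/ler_addgt0Pr => e e0.
  have eu0 : 0 <^v e *: u.
    case/andP: u0 => u0 un0; rewrite eq_sym scaler_eq0 gt_eqF//= eq_sym un0 andbT.
    by have [_ _ CZ] := @positive_convex_cone _ Y; exact: CZ (ltW e0) u0.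
  have := p_improves _ _ (improves_add hmono (hx i) eu0).
  have pe : p (fun=> e *: u) = e by rewrite -[RHS]mulr1 -pu -[RHS]linearZ.
  by rewrite linearD/= pe.
(* By feasibility the nonnegative excesses [p (x i) - p (endowment E i)] have a
   nonpositive sum. *)
have eq_ax i : p (x i) = p (endowment E i).
  apply/eqP; rewrite -subr_eq0; apply/eqP.
  pose excess j := p (x j) - p (endowment E j).
  apply: (psumr_eq0P (P := predT) (F := excess)) => // [j _|].
    by rewrite subr_ge0.
  apply/le_anti; rewrite sumr_ge0 ?andbT => [|j _]; last by rewrite subr_ge0.
  rewrite sumrB -!linear_sum subr_le0 -subr_ge0 -linearB; apply: p_ge0 => w.
  have := iffLR (vle_sub _ _) (feasE w).
  by rewrite -[X in _ -> positive_cone Y X]/(_ w - _ w) !fct_sumE.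
have value_x i : value pi (x i) = value pi (endowment E i).
  by rewrite (value_info i _ (hx i).2) (value_info i)// eq_ax.
have a_ge0 i : 0 <= value pi (endowment E i).
  by rewrite (value_info i)// p_ge0// => w; exact: endowment_pos.
have [i0 a_i0] : exists i, value pi (endowment E i) != 0.
  apply: contrapT => /forallNP a0.
  have {}a0 i : value pi (endowment E i) = 0 by apply/eqP/negP => /negP; exact: a0.
  have pi_a w : pi w (\sum_i endowment E i w) <= 0.
    have : value pi (fun w => \sum_i 1 *: endowment E i w) = 0.
      by rewrite value_linear_comb big1// => i _; rewrite a0 mulr0.
    rewrite /value => /psumr_eq0P va.
    rewrite -(eq_bigr _ (fun i _ => scale1r (endowment E i w))).
    rewrite va// => w' _; apply/pi_pos/positive_sum => i _; rewrite scale1r.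
    exact: endowment_pos.
  suff : value pi (fun=> u) <= 0 by rewrite value_u ler10.
  apply: sumr_le0 => w _.
  exact: quasi_interior_price (pi_pos w) ui (hquasi w) (pi_a w).
exists pi; split; last first.
  exists (agents_of_type i0).
    split; [exact: agents_of_type_measurable|exact: agents_of_type_sub|].
    by rewrite agents_of_type_measure lte_fin invr_gt0 ltr0n.
  by move=> t it; rewrite /endowment_c (agent_typeP it).
split; [exact: hf|exact: hfeas| | |].
- split=> [w|q|].
  + by split; [apply: positive_linear_continuous; [exists u|exact: pi_pos]|exact: pi_pos].
  + apply: saturated_measurable => // w w' ww' /= <-; apply/esym.
    exact: averaged_price_atom.
  + apply: contrapT => pi0; have := value_u; rewrite /value big1 => [/eqP|w _].
      by rewrite eq_sym oner_eq0.
    by apply/eqP/negP => /negP piu; apply: pi0; exists w, u.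
- move=> t tA; have [i it] := agents_of_type_cover (n := n) tA.
  rewrite /budget_c /endowment_c /expected_utility_c (agent_typeP it) (hfx _ _ it).
  split; first by split; rewrite // value_x.
  move=> ai y [yC ya]; rewrite leNgt; apply/negP => xy.
  have yi : improves E x i y by [].
  (* [r *: y] is still improving, but cheaper than the endowment. *)
  have [r [r0 r1 ry]] := improves_scale hcont yi.
  have ai_gt0 : 0 < p (endowment E i).
    by rewrite -(value_info i)// lt_neqAle eq_sym ai a_ge0.
  have := p_improves _ _ ry; rewrite linearZ/= leNgt => /negP; apply.
  move: ya; rewrite (value_info i _ yC.2) (value_info i)//.
  move=> ya; apply: (le_lt_trans (ler_wpM2l (ltW r0) ya)).
  by rewrite gtr_pMl.
- under [in LHS]eq_fun do rewrite (agents_bochner_integral _ hfx).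
  under [in RHS]eq_fun do rewrite (agents_bochner_integral _ hfa).
  by rewrite !value_linear_comb; apply: eq_bigr => i _; rewrite value_x.
Qed.
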